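(* Let $n\ge 4$ be even. (i) Every tiling of the first quadrant $Q_1=[0,\infty)^2$ by $\mathcal{T}_n^+$, and every tiling of $Q_1$ by $\mathcal{T}_n$, follows the rectangular pattern. (ii) Let $R$ be an $a\times b$ rectangle with $a,b$ positive integers, at least one of which is odd (i.e. $R$ is even$\times$odd, odd$\times$even or odd$\times$odd). Then there exists a tiling of $Q_1$ by $\mathcal{T}_n^+\cup\{R\}$ that does not follow the rectangular pattern, and there exists a tiling of $Q_1$ by $\mathcal{T}_n\cup\{R\}$ that does not follow the rectangular pattern.
   Context: A cell is a unit square $[i,i+1]\times[j,j+1]$ with $i,j\in\mathbb{Z}$; write $(i,j)$ for it. Define the following polyominoes (sets of cells, considered up to translation by integer vectors): $T_1=\{(0,j):0\le j\le n-2\}\cup\{(1,0)\}$; $T_2=\{(1,j):0\le j\le n-2\}\cup\{(0,n-2)\}$; $T_3=\{(i,0):0\le i\le n-2\}\cup\{(0,1)\}$; $T_4=\{(i,1):0\le i\le n-2\}\cup\{(n-2,0)\}$; $T_5=\{(0,0),(1,0),(0,1),(1,1)\}$ (a $2\times 2$ square). $T_1,\dots,T_4$ are the ribbon $L$-shaped $n$-ominoes. Let $\mathcal{T}_n=\{T_1,T_2,T_3,T_4\}$ and $\mathcal{T}_n^+=\{T_1,\dots,T_5\}$. A tiling of a region by a set of tiles is a covering of the region by translates by integer vectors (no rotations or reflections) of tiles from the set, with pairwise disjoint interiors. An $a\times b$ rectangle has height $a$ and base $b$. A rectangle is called even if all coordinates of its vertices are even. A tiling follows the rectangular pattern on a region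 $P$ if $P$ is the union of non-overlapping even rectangles each of which is either a $2\times 2$ square that is a single $T_5$ tile of the tiling, or a $2\times n$ or $n\times 2$ rectangle that is exactly the union of two ribbon $L$-shaped $n$-omino tiles of the tiling. A tiling of $Q_1$ follows the rectangular pattern if $Q_1$ itself follows it, i.e. the tiling reduces to a tiling by such $2\times2$, $2\times n$, $n\times 2$ rectangles. *)

(* Defs.v *)
From HB Require Import structures.
From mathcomp Require Import all_boot all_order all_algebra.
From mathcomp Require Import boolp classical_sets.

Set Implicit Arguments.
Unset Strict Implicit.
Unset Printing Implicit Defensive.

Import Order.TTheory GRing.Theory Num.Theory.

Local Open Scope classical_set_scope.
Local Open Scope ring_scope.

(* (i, j) stands for the unit square [i, i+1] x [j, j+1].  Regions and tiles
   are unions of cells, hence sets of cells; such unions have disjoint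
   interiors exactly when they have no cell in common. *)
Definition cell : Type := (int * int)%type.

Definition translate (v : cell) (A : set cell) : set cell :=
  [set c + v | c in A].

Definition T1 (n : nat) : set cell :=
  [set c | c.1 = 0 /\ 0 <= c.2 <= n%:Z - 2] `|` [set (1, 0)].
Definition T2 (n : nat) : set cell :=
  [set c | c.1 = 1 /\ 0 <= c.2 <= n%:Z - 2] `|` [set (0, n%:Z - 2)].
Definition T3 (n : nat) : set cell :=
  [set c | c.2 = 0 /\ 0 <= c.1 <= n%:Z - 2] `|` [set (0, 1)].
Definition T4 (n : nat) : set cell :=
  [set c | c.2 = 1 /\ 0 <= c.1 <= n%:Z - 2] `|` [set (n%:Z - 2, 0)].
Definition T5 : set cell :=
  [set ((0, 0) : cell); (1, 0); (0, 1); (1, 1)].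

Definition ribbonL (n : nat) : set (set cell) :=
  [set T1 n; T2 n; T3 n; T4 n].
Definition ribbonL_plus (n : nat) : set (set cell) :=
  ribbonL n `|` [set T5].

Definition Q1 : set cell := [set c | 0 <= c.1 /\ 0 <= c.2].

(* The rectangle with lower left vertex (x, y), height a and base b. *)
Definition rectangle (x y : int) (a b : nat) : set cell :=
  [set c | x <= c.1 < x + b%:Z /\ y <= c.2 < y + a%:Z].

Definition even_vertices (x y : int) (a b : nat) : Prop :=
  [/\ (2 %| x)%Z, (2 %| y)%Z, (2 %| x + b%:Z)%Z & (2 %| y + a%:Z)%Z].

Definition translate_from (S : set (set cell)) (A : set cell) : Prop :=
  exists T v, S T /\ A = translate v T.

(* A tiling is the set of its (placed) tiles. *)
Definition tiling (P : set cell) (S tau : set (set cell)) : Prop :=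
  (forall A, tau A -> translate_from S A) /\
  classical_sets.partition tau id P.

Definition single_square (tau : set (set cell)) (D : set cell) : Prop :=
  tau D /\ translate_from [set T5] D.

Definition two_ribbonL (n : nat) (tau : set (set cell)) (D : set cell) : Prop :=
  exists A B, [/\ tau A /\ translate_from (ribbonL n) A,
                  tau B /\ translate_from (ribbonL n) B,
                  A <> B & D = A `|` B].

Definition pattern_rectangle (n : nat) (tau : set (set cell)) (D : set cell)
    : Prop :=
  exists x y a b,
    [/\ D = rectangle x y a b, even_vertices x y a b &
        (a = 2%N /\ b = 2%N /\ single_square tau D) \/
        (((a = 2%N /\ b = n) \/ (a = n /\ b = 2%N)) /\ two_ribbonL n tau D)].

Definition follows_rectangular_pattern (n : nat) (tau : set (set cell))
    (P : set cell) : Prop :=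
  exists F : set (set cell),
    (forall D, F D -> pattern_rectangle n tau D) /\
    classical_sets.partition F id P.

(* Main.v *)
Require Import Defs.
From mathcomp Require Import all_boot all_order all_algebra.
From mathcomp Require Import boolp classical_sets.
From mathcomp Require Import zify.

Set Implicit Arguments.
Unset Strict Implicit.
Unset Printing Implicit Defensive.

Import Order.TTheory GRing.Theory Num.Theory.

Local Open Scope classical_set_scope.
Local Open Scope ring_scope.

(** Call a tile settled when it is half of a pattern rectangle with even
    vertices, or a square with even vertices, and call a cell stray when its
    tile is not settled.  Stray cells fill whole tiles and whole 2x2 blocks, so
    at a minimal stray block the tile over the lower left cell is nearly forced.
    It is of one of two types: either it forces a tile to stick out downwards
    further to the right, or, by reflection in the diagonal, it forces a tile to
    stick out leftwards further up.  Among the minimal stray blocks, ordered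
    along their staircase, the lowest one cannot be of the first type nor the
    leftmost one of the second type, so two consecutive ones head towards each
    other; the tile over the inner corner of the staircase between them cannot
    obey both.

    As for the second part, copies of an odd rectangle tile the quadrant as a
    grid, without any other tile. *)

Lemma ex_least_int (Q : int -> Prop) :
  (forall i, Q i -> 0 <= i) -> (exists i, Q i) ->
  exists2 i, Q i & forall i', Q i' -> i <= i'.
Proof.
move=> Q_ge0 [i0 Qi0].
have [|k /asboolP Qk k_min] := @ex_minnP (fun k : nat => `[< Q k%:Z >]).
  by exists `|i0|%N; apply/asboolP; rewrite gez0_abs ?Q_ge0.
exists k%:Z => // i Qi; rewrite -(gez0_abs (Q_ge0 _ Qi)) lez_nat.
by apply: k_min; apply/asboolP; rewrite gez0_abs ?Q_ge0.
Qed.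

Lemma partition_image (I T : Type) (D : set I) (B : I -> set T) (P : set T) :
  cover D B = P -> (forall i, D i -> B i !=set0) ->
  (forall i j, D i -> D j -> B i `&` B j !=set0 -> B i = B j) ->
  classical_sets.partition (B @` D) id P.
Proof.
move=> covP B_neq0 B_triv; split=> [||_ [i Di <-]]; last exact: B_neq0.
- by rewrite coverE bigcup_image.
- by move=> _ _ [i Di <-] [j Dj <-]; apply: B_triv.
Qed.

Lemma cell_setP (A B : set cell) :
  (forall u v, A (u, v) <-> B (u, v)) -> A = B.
Proof. by move=> AB; apply/seteqP; split=> -[u v] /AB. Qed.

Lemma translateE (x y u v : int) (A : set cell) :
  translate (x, y) A (u, v) <-> A (u - x, v - y).
Proof.
split=> [[[c d] Acd [<- <-]]|Auv]; first by rewrite !addrK.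
by exists (u - x, v - y) => //; congr pair; rewrite /= subrK.
Qed.

Lemma translate_rectangle (x y z w : int) (a b : nat) :
  translate (z, w) (rectangle x y a b) = rectangle (x + z) (y + w) a b.
Proof. by apply: cell_setP => u v; rewrite translateE /rectangle /=; lia. Qed.

Lemma tiling_subset P S S' tau : S `<=` S' -> tiling P S tau -> tiling P S' tau.
Proof.
move=> SS' [tiles tau_part]; split=> // A /tiles [T [v [ST ->]]].
by exists T, v; split=> //; apply: SS'.
Qed.

(** * Tiles and their pattern rectangles *)

(* T2 raised by one unit completes T1 to a rectangle of height n and base 2, and
   T4 moved right by one unit completes T3 to its mirror image. *)
Inductive kind := LeftHalf | RightHalf | LowerHalf | UpperHalf | Square.

Definition placed : Type := (kind * int * int)%type.

Section RibbonTilings.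

Variable n : nat.

Definition tile (k : kind) : set cell :=
  match k with
  | LeftHalf => T1 n
  | RightHalf => T2 n
  | LowerHalf => T3 n
  | UpperHalf => T4 n
  | Square => T5
  end.

Definition placed_tile (t : placed) : set cell :=
  let: (k, x, y) := t in translate (x, y) (tile k).

Definition covers (t : placed) (u v : int) : bool :=
  let: (k, x, y) := t in
  match k with
  | LeftHalf =>
      (u == x) && (y <= v <= y + n%:Z - 2) || (u == x + 1) && (v == y)
  | RightHalf =>
      (u == x + 1) && (y <= v <= y + n%:Z - 2) ||
      (u == x) && (v == y + n%:Z - 2)
  | LowerHalf =>
      (v == y) && (x <= u <= x + n%:Z - 2) || (u == x) && (v == y + 1)
  | UpperHalf =>
      (v == y + 1) && (x <= u <= x + n%:Z - 2) ||
      (u == x + n%:Z - 2) && (v == y)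
  | Square => (x <= u <= x + 1) && (y <= v <= y + 1)
  end.

Lemma placed_tileE t u v : placed_tile t (u, v) <-> covers t u v.
Proof.
case: t => [[k x] y].
have pairE (a b c d : int) : ((a, b) = (c, d)) = (a = c /\ b = d).
  by apply/propext; split=> [[-> ->]|[-> ->]].
rewrite /placed_tile translateE; case: k;
  rewrite /tile /T1 /T2 /T3 /T4 /T5 /setU /= ?pairE; lia.
Qed.

Lemma translate_from_ribbonL_plus A :
  translate_from (ribbonL_plus n) A <-> exists t, A = placed_tile t.
Proof.
split=> [[T [[x y] [ST ->]]]|[[[k x] y] ->]].
  have [k ->] : exists k, T = tile k.
    by case: ST => [[[[]|]|]|] ->; [exists LeftHalf|exists RightHalf|
      exists LowerHalf|exists UpperHalf|exists Square].
  by exists (k, x, y).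
exists (tile k), (x, y); split=> //.
by case: k; rewrite /ribbonL_plus /ribbonL /=; tauto.
Qed.

Lemma translate_from_ribbonL t :
  t.1.1 <> Square -> translate_from (ribbonL n) (placed_tile t).
Proof.
case: t => [[k x] y] k_ribbon; exists (tile k), (x, y); split=> //.
by case: k k_ribbon => //=; rewrite /ribbonL /=; tauto.
Qed.

Definition partner (t : placed) : placed :=
  let: (k, x, y) := t in
  match k with
  | LeftHalf => (RightHalf, x, y + 1)
  | RightHalf => (LeftHalf, x, y - 1)
  | LowerHalf => (UpperHalf, x + 1, y)
  | UpperHalf => (LowerHalf, x - 1, y)
  | Square => t
  end.

Definition hull_corner (t : placed) : int * int :=
  let: (k, x, y) := t in
  match k with
  | RightHalf => (x, y - 1)
  | UpperHalf => (x - 1, y)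
  | _ => (x, y)
  end.

Definition hull_height (t : placed) : nat :=
  let: (k, _, _) := t in match k with LeftHalf | RightHalf => n | _ => 2 end.

Definition hull_base (t : placed) : nat :=
  let: (k, _, _) := t in match k with LowerHalf | UpperHalf => n | _ => 2 end.

Definition hull (t : placed) : set cell :=
  rectangle (hull_corner t).1 (hull_corner t).2 (hull_height t) (hull_base t).

Definition flip_kind (k : kind) : kind :=
  match k with
  | LeftHalf => LowerHalf
  | RightHalf => UpperHalf
  | LowerHalf => LeftHalf
  | UpperHalf => RightHalf
  | Square => Square
  end.

Definition flip (t : placed) : placed :=
  let: (k, x, y) := t in (flip_kind k, y, x).

Lemma flipK : involutive flip.
Proof. by case=> [[[] x] y]. Qed.

Lemma covers_flip t u v : covers (flip t) u v = covers t v u.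
Proof. by case: t => [[[] x] y] /=; lia. Qed.

Lemma partnerK : involutive partner.
Proof. by case=> [[[] x] y] //=; rewrite ?addrK ?subrK. Qed.

Lemma partner_flip t : partner (flip t) = flip (partner t).
Proof. by case: t => [[[] x] y]. Qed.

Lemma hull_partner t : hull (partner t) = hull t.
Proof. by case: t => [[[] x] y] //; rewrite /hull /= addrK. Qed.

Hypothesis n_ge4 : (4 <= n)%N.

Lemma rectangle_eq_tile x y a b t :
  rectangle x y a b = placed_tile t -> a = 2%N /\ b = 2%N.
Proof.
move=> rect_t.
have rectE u v : x <= u < x + b%:Z /\ y <= v < y + a%:Z <-> covers t u v.
  by rewrite -placed_tileE -rect_t.
(* A ribbon contains two diagonal cells of the 2x2 square around its bend, but
   misses one of the other two. *)
case: t {rect_t} rectE => [[[] z] w] /= rectE.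
- have := rectE z (w + 1); have := rectE (z + 1) w.
  have := rectE (z + 1) (w + 1); lia.
- have := rectE z (w + n%:Z - 2); have := rectE (z + 1) (w + n%:Z - 3).
  have := rectE z (w + n%:Z - 3); lia.
- have := rectE z (w + 1); have := rectE (z + 1) w.
  have := rectE (z + 1) (w + 1); lia.
- have := rectE (z + n%:Z - 2) w; have := rectE (z + n%:Z - 3) (w + 1).
  have := rectE (z + n%:Z - 3) w; lia.
- have := rectE z w; have := rectE (z + 1) (w + 1); have := rectE (z - 1) w.
  have := rectE (z + 2) w; have := rectE z (w - 1); have := rectE z (w + 2).
  lia.
Qed.

Lemma covers_subset_offset k x y k' x' y' :
  (forall u v, covers (k, x, y) u v -> covers (k', x', y') u v) ->
  x' <= x /\ y' <= y.
Proof.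
move=> sub_kk'.
have [v /sub_kk' xv] : exists v, covers (k, x, y) x v.
  case: k {sub_kk'}; [exists y|exists (y + n%:Z - 2)|exists y|exists (y + 1)|
    exists y]; rewrite /=; lia.
have [u /sub_kk' uy] : exists u, covers (k, x, y) u y.
  case: k {sub_kk' xv}; [exists x|exists (x + 1)|exists x|exists (x + n%:Z - 2)|
    exists x]; rewrite /=; lia.
by case: k' {sub_kk'} xv uy => /=; lia.
Qed.

Lemma placed_tile_inj : injective placed_tile.
Proof.
move=> [[k x] y] [[k' x'] y'] tile_eq.
have coversE u v : covers (k, x, y) u v = covers (k', x', y') u v.
  by apply/idP/idP; rewrite -!placed_tileE tile_eq.
have [|le_x' le_y'] := @covers_subset_offset k x y k' x' y'.
  by move=> u v; rewrite coversE.
have [|le_x le_y] := @covers_subset_offset k' x' y' k x y.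
  by move=> u v; rewrite coversE.
have [ex ey] : x = x' /\ y = y' by lia.
rewrite {}ex {}ey in coversE *; congr (_, _, _).
have := coversE x' y'; have := coversE (x' + 1) y'; have := coversE x' (y' + 1).
have := coversE (x' + 1) (y' + 1); have := coversE (x' + 2) y'.
by case: k {coversE tile_eq}; case: k' => //=; lia.
Qed.

Lemma hullE t u v : hull t (u, v) <-> covers t u v || covers (partner t) u v.
Proof. by case: t => [[[] x] y]; rewrite /hull /rectangle /=; lia. Qed.

Lemma hull_tiles t : hull t = placed_tile t `|` placed_tile (partner t).
Proof.
apply: cell_setP => u v; rewrite hullE.
by split=> [/orP|] [?|?]; [left|right|apply/orP; left|apply/orP; right];
  apply/placed_tileE.
Qed.

(** * Tilings of the quadrant and stray cells *)

Record tiles_quadrant (P : set placed) : Prop := TilesQuadrant {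
  covered : forall u v, 0 <= u -> 0 <= v -> exists2 t, P t & covers t u v;
  covers_ge0 : forall t u v, P t -> covers t u v -> 0 <= u /\ 0 <= v;
  covers_unique : forall t t' u v,
    P t -> P t' -> covers t u v -> covers t' u v -> t = t' }.

Lemma tiles_quadrant_flip P : tiles_quadrant P -> tiles_quadrant (flip @^-1` P).
Proof.
move=> tP; split=> [u v u0 v0|t u v Pt|t t' u v Pt Pt'].
- have [t Pt tvu] := covered tP v0 u0.
  by exists (flip t); rewrite ?covers_flip //= flipK.
- by rewrite -covers_flip => /(covers_ge0 tP Pt) [].
- rewrite -!(covers_flip _ v) => tvu t'vu; apply: (inv_inj flipK).
  exact: (covers_unique tP _ _ tvu t'vu).
Qed.

Definition even_hull (t : placed) : bool :=
  (2 %| (hull_corner t).1)%Z && (2 %| (hull_corner t).2)%Z.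

Definition settled (P : set placed) (t : placed) : Prop :=
  [/\ P t, P (partner t) & even_hull t].

Definition stray (P : set placed) (u v : int) : Prop :=
  exists t, [/\ P t, covers t u v & ~ settled P t].

Lemma even_hull_partner t : even_hull (partner t) = even_hull t.
Proof. by case: t => [[[] x] y]; rewrite /even_hull /= ?addrK. Qed.

Lemma even_hull_flip t : even_hull (flip t) = even_hull t.
Proof. by case: t => [[[] x] y]; rewrite /even_hull /= andbC. Qed.

Lemma settled_partner P t : settled P (partner t) <-> settled P t.
Proof. by split=> -[]; rewrite /settled partnerK even_hull_partner. Qed.

Lemma settled_flip P t : settled (flip @^-1` P) (flip t) <-> settled P t.
Proof. by rewrite /settled /= partner_flip !flipK even_hull_flip. Qed.

Lemma stray_flip P u v : stray (flip @^-1` P) u v <-> stray P v u.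
Proof.
split=> -[t [Pt tuv t_unsettled]]; exists (flip t); split=> //.
- by rewrite covers_flip.
- by rewrite -(settled_flip P) flipK.
- by rewrite /= flipK.
- by rewrite covers_flip.
- by rewrite settled_flip.
Qed.

Hypothesis n_even : ~~ odd n.

Lemma even_hull_block t u v u' v' :
  even_hull t -> (u %/ 2 = u' %/ 2)%Z -> (v %/ 2 = v' %/ 2)%Z ->
  hull t (u, v) -> hull t (u', v').
Proof.
by case: t => [[[] x] y]; rewrite /even_hull /hull /rectangle /=; lia.
Qed.

Section StrayCells.

Variables (P : set placed) (tP : tiles_quadrant P).

Lemma covers_disjoint t t' u v u' v' :
  P t -> P t' -> covers t u v -> ~~ covers t' u v ->
  covers t' u' v' -> ~~ covers t u' v'.
Proof.
move=> Pt Pt' tuv t'Nuv t'uv'; apply: contraNN t'Nuv => tuv'.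
by rewrite -(covers_unique tP Pt Pt' tuv' t'uv').
Qed.

Lemma stray_ge0 u v : stray P u v -> 0 <= u /\ 0 <= v.
Proof. by move=> [t [Pt tuv _]]; apply: (covers_ge0 tP Pt tuv). Qed.

Lemma stray_not_settled t u v :
  P t -> covers t u v -> stray P u v -> ~ settled P t.
Proof.
move=> Pt tuv [t' [Pt' t'uv]].
by rewrite (covers_unique tP Pt Pt' tuv t'uv).
Qed.

Lemma stray_covers t u v u' v' :
  P t -> covers t u v -> stray P u v -> covers t u' v' -> stray P u' v'.
Proof.
by move=> Pt tuv /(stray_not_settled Pt tuv) t_unsettled t'; exists t.
Qed.

Lemma stray_block u v u' v' :
  (u %/ 2 = u' %/ 2)%Z -> (v %/ 2 = v' %/ 2)%Z -> stray P u v -> stray P u' v'.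
Proof.
move=> eu ev uv_stray; have [u0 v0] := stray_ge0 uv_stray.
have [||t Pt tuv'] := covered tP (u := u') (v := v'); [by lia..|].
exists t; split=> // t_settled; have [_ Pt' t_even] := t_settled.
have : hull t (u, v).
  by apply: (even_hull_block t_even (esym eu) (esym ev)); apply/hullE/orP; left.
case/hullE/orP=> tuv; first exact: (stray_not_settled Pt tuv).
by apply: (stray_not_settled Pt' tuv) => //; apply/settled_partner.
Qed.

Lemma stray_even_corner u v :
  stray P u v -> stray P (2 * (u %/ 2)%Z) (2 * (v %/ 2)%Z).
Proof. by apply: stray_block; lia. Qed.

End StrayCells.

(** * The staircase of minimal stray blocks *)

Definition clear (P : set placed) (I J : int) : Prop :=
  forall u v, u < 2 * I -> v < 2 * J -> ~ stray P u v.

Definition stray_corner (P : set placed) (i j : int) : Prop :=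
  stray P (2 * i) (2 * j) /\
  forall u v, stray P u v -> u < 2 * i + 2 -> v < 2 * j + 2 ->
    2 * i <= u /\ 2 * j <= v.

Definition heads_down (P : set placed) (i j : int) : Prop :=
  P (LeftHalf, 2 * i, 2 * j) \/ P (UpperHalf, 2 * i, 2 * j - 1).

Definition heads_left (P : set placed) (i j : int) : Prop :=
  heads_down (flip @^-1` P) j i.

(* How a corner heading down from further left constrains the tile [t] over the
   inner corner (2 I, 2 J) of the staircase: [t] is a bar coming from the left,
   or a bar hanging down beside the tile of the corner, at odd height, or it is
   enclosed from the left and from above. *)
Definition forced_from_left (I J : int) (t : placed) : Prop :=
  let: (k, x, y) := t in
  [\/ [/\ k = UpperHalf, (2 %| x)%Z & covers t (2 * I - 1) (2 * J)],
      k = RightHalf /\ ~~ (2 %| y)%Z |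
      ~~ covers t (2 * I - 1) (2 * J) /\ ~~ covers t (2 * I) (2 * J + 1)].

Definition forced_at (P : set placed) (I J : int) : Prop :=
  exists t, [/\ P t, covers t (2 * I) (2 * J) & forced_from_left I J t].

Lemma forced_from_left_flip_absurd I J t :
  covers t (2 * I) (2 * J) -> forced_from_left I J t ->
  ~ forced_from_left J I (flip t).
Proof.
case: t => [[[] x] y] /= tIJ;
  by move=> [[? ? ?]|[? ?]|[? ?]] [[? ? ?]|[? ?]|[? ?]] //; lia.
Qed.

Lemma forced_at_flip_absurd P I J :
  tiles_quadrant P -> forced_at P I J -> ~ forced_at (flip @^-1` P) J I.
Proof.
move=> tP [t [Pt tIJ left_t]] [t' [Pt' t'JI below_t']].
apply: (forced_from_left_flip_absurd tIJ left_t).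
have <- // : t' = flip t.
apply/(canRL flipK); apply: (covers_unique tP Pt' Pt _ tIJ).
by rewrite covers_flip.
Qed.

Lemma clear_flip P I J : clear (flip @^-1` P) J I <-> clear P I J.
Proof.
by split=> IJ_clear u v uI vJ; [rewrite -stray_flip|rewrite stray_flip];
  apply: IJ_clear.
Qed.

Lemma forced_from_left_clear_below I J t :
  covers t (2 * I) (2 * J) -> forced_from_left I J t ->
  ~~ covers t (2 * I - 1) (2 * J) -> ~~ covers t (2 * I) (2 * J - 1) ->
  ~~ covers t (2 * I + 1) (2 * J - 1) -> t = (UpperHalf, 2 * I, 2 * J - 1).
Proof.
case: t => [[k x] y] tIJ left_t tNleft tNbelow tNbelow_right.
have [-> -> ->] : [/\ k = UpperHalf, x = 2 * I & y = 2 * J - 1]; last by [].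
case: left_t => [[_ _ t_left]|[k_right y_odd]|[_ tNabove]].
- by rewrite t_left in tNleft.
- by move: tIJ tNbelow; rewrite k_right /=; lia.
- by case: k tIJ tNleft tNbelow tNbelow_right tNabove => /= *; split=> //; lia.
Qed.

(* (x + 1, y + 1) is the cell between the two arms of the ribbon. *)
Lemma left_half_notch x y s :
  covers s (x + 1) (y + 1) ->
  (forall u v, covers (LeftHalf, x, y) u v -> ~~ covers s u v) ->
  s = partner (LeftHalf, x, y) \/
  covers s (x + 2) (y + 1) /\
    (covers s (x + 2) y -> s = (RightHalf, x + 1, y + 3 - n%:Z)).
Proof.
move=> s_notch s_apart.
have := s_apart x (y + 1); have := s_apart (x + 1) y; have := s_apart x (y + 2).
case: s {s_apart} s_notch => [[[] z] w] /= s_notch ? ? ?;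
  try by right; lia.
have [zx|zx] : z = x \/ z = x + 1 by lia.
  by left; congr (_, _, _); lia.
by right; split; [lia|move=> _; congr (_, _, _); lia].
Qed.

Section StaircaseCorners.

Variables (P : set placed) (tP : tiles_quadrant P).

Lemma stray_corner_heads i j :
  stray_corner P i j -> heads_down P i j \/ heads_left P i j.
Proof.
move=> [ij_stray ij_min]; have [i0 j0] := stray_ge0 tP ij_stray.
have [t Pt tij] := covered tP i0 j0.
have t_min u v : covers t u v -> u < 2 * i + 2 -> v < 2 * j + 2 ->
    2 * i <= u /\ 2 * j <= v.
  by move=> tuv; apply: ij_min; apply: (stray_covers tP Pt tij).
have := t_min (2 * i - 1) (2 * j); have := t_min (2 * i) (2 * j - 1).
have := t_min (2 * i - 1) (2 * j + 1); have := t_min (2 * i + 1) (2 * j - 1).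
have := stray_not_settled tP Pt tij ij_stray.
case: t => [[[] x] y] /= in Pt tij {t_min} * => t_unsettled ? ? ? ?.
- have [ex ey] : x = 2 * i /\ y = 2 * j by lia.
  by left; left; rewrite -ex -ey.
- have [ex ey] : x = 2 * i - 1 /\ y = 2 * j by lia.
  by right; right; rewrite -ex -ey.
- have [ex ey] : x = 2 * i /\ y = 2 * j by lia.
  by right; left; rewrite -ex -ey.
- have [ex ey] : x = 2 * i /\ y = 2 * j - 1 by lia.
  by left; right; rewrite -ex -ey.
- case: t_unsettled; split=> //; rewrite /even_hull /=; lia.
Qed.

Lemma upper_half_forces i I J :
  P (UpperHalf, 2 * i, 2 * J - 1) -> stray P (2 * i) (2 * J) ->
  i < I -> clear P I J -> forced_at P I J /\ 2 * I <= 2 * i + n%:Z - 2.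
Proof.
set t := (UpperHalf, _, _) => Pt iJ_stray iI IJ_clear.
have head_stray : stray P (2 * i + n%:Z - 2) (2 * J - 1).
  by apply: (stray_covers tP Pt _ iJ_stray) => /=; lia.
have I_le : 2 * I <= 2 * i + n%:Z - 2.
  by rewrite leNgt; apply/negP => lt_I; apply: IJ_clear head_stray; lia.
split=> //; exists t; split=> //=; first by lia.
by constructor 1; split=> //; lia.
Qed.

Lemma left_half_forces i j :
  P (LeftHalf, 2 * i, 2 * j) -> stray P (2 * i) (2 * j) ->
  stray P (2 * (i + 1)) (2 * j) /\ forced_at P (i + 1) j.
Proof.
move=> Pl ij_stray; have [i0 j0] := stray_ge0 tP ij_stray.
have [||s Ps s_notch] := covered tP (u := 2 * i + 1) (v := 2 * j + 1); [lia..|].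
have [|s_l|[s_over s_under]] := left_half_notch s_notch.
- by move=> u v; apply: (covers_disjoint tP Ps Pl s_notch) => /=; lia.
- case: (stray_not_settled tP Pl _ ij_stray); first by move=> /=; lia.
  by split; rewrite -?s_l // /even_hull /=; lia.
have two_succ : 2 * i + 2 = 2 * (i + 1) by lia.
rewrite two_succ in s_over s_under.
split.
  have notch_stray : stray P (2 * i + 1) (2 * j + 1).
    by apply: (stray_block tP _ _ ij_stray); lia.
  have over_stray := stray_covers tP Ps s_notch notch_stray s_over.
  by apply: (stray_block tP _ _ over_stray); lia.
have [s_hit|sN] := boolP (covers s (2 * (i + 1)) (2 * j)).
  by exists s; split=> //; rewrite s_under //=; constructor 2; split=> //; lia.
have [||t Pt tij] := covered tP (u := 2 * (i + 1)) (v := 2 * j); [lia..|].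
exists t; split=> //; case: t => [[k x] y] in Pt tij *; constructor 3; split.
- by apply: (covers_disjoint tP Pt Pl tij) => /=; lia.
- exact: (covers_disjoint tP Pt Ps tij sN s_over).
Qed.

Lemma heads_down_forces i I J :
  stray P (2 * i) (2 * J) -> heads_down P i J -> i < I -> clear P I J ->
  forced_at P I J /\ 2 * I <= 2 * i + n%:Z.
Proof.
move=> iJ_stray [Pl|Pu] iI IJ_clear; last first.
  by have [] := upper_half_forces Pu iJ_stray iI IJ_clear; split=> //; lia.
have [next_stray next_forced] := left_half_forces Pl iJ_stray.
have [<-|i1I] : i + 1 = I \/ i + 1 < I by lia.
  by split=> //; lia.
have [t [Pt tij left_t]] := next_forced.
have t_clear u v : u < 2 * I -> v < 2 * J -> ~~ covers t u v.
  move=> uI vJ; apply/negP => /(stray_covers tP Pt tij next_stray).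
  exact: IJ_clear.
have t_upper : t = (UpperHalf, 2 * (i + 1), 2 * J - 1).
  apply: (forced_from_left_clear_below tij left_t).
  - by apply: (covers_disjoint tP Pt Pl tij) => /=; lia.
  - by apply: t_clear; lia.
  - by apply: t_clear; lia.
rewrite t_upper in Pt.
by have [] := upper_half_forces Pt next_stray i1I IJ_clear; split=> //; lia.
Qed.

Lemma lowest_stray_corner (W : int -> Prop) :
  (forall i i', W i -> i' <= i -> W i') ->
  (exists u v, W (u %/ 2)%Z /\ stray P u v) ->
  exists i j, [/\ W i, stray_corner P i j &
    forall u v, W (u %/ 2)%Z -> v < 2 * j -> ~ stray P u v].
Proof.
move=> W_down [u0 [v0 [Wu0 uv0_stray]]].
have [||j [i0 [Wi0 i0j_stray]] j_min] :=
    @ex_least_int (fun j => exists i, W i /\ stray P (2 * i) (2 * j)).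
- by move=> j [i [_ /(stray_ge0 tP)]]; lia.
- by exists (v0 %/ 2)%Z, (u0 %/ 2)%Z; split=> //; exact: (stray_even_corner tP).
have [||i [Wi ij_stray] i_min] :=
    @ex_least_int (fun i => W i /\ stray P (2 * i) (2 * j)).
- by move=> i [_ /(stray_ge0 tP)]; lia.
- by exists i0.
exists i, j; split=> // [|u v Wu vj /(stray_even_corner tP) uv_stray].
  split=> // u v /(stray_even_corner tP) uv_stray ui vj.
  have Wu : W (u %/ 2)%Z by apply: W_down Wi _; lia.
  have j_le : j <= (v %/ 2)%Z by apply: j_min; exists (u %/ 2)%Z.
  have i_le : i <= (u %/ 2)%Z.
    by apply: i_min; split=> //; have -> : j = (v %/ 2)%Z by lia.
  by lia.
suff : j <= (v %/ 2)%Z by lia.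
by apply: j_min; exists (u %/ 2)%Z.
Qed.

End StaircaseCorners.

Lemma stray_corner_not_heads_left P i j :
  tiles_quadrant P -> stray_corner P i j -> ~ heads_left P i j.
Proof.
move=> tP ij_corner ij_left.
have [||I [J [IJ_corner IJ_left]] I_min] :=
    @ex_least_int (fun I => exists J, stray_corner P I J /\ heads_left P I J).
- by move=> I [J [[/(stray_ge0 tP)]]]; lia.
- by exists i, j.
have [IJ_stray IJ_first] := IJ_corner.
have forced_above K : J < K -> clear P I K ->
    forced_at (flip @^-1` P) K I /\ 2 * K <= 2 * J + n%:Z.
  move=> JK IK_clear.
  apply: (heads_down_forces (tiles_quadrant_flip tP) _ IJ_left JK).
    by rewrite stray_flip.
  by rewrite clear_flip.
have [left_stray|left_clear] :=
    pselect (exists u v, (u %/ 2)%Z < I /\ stray P u v); last first.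
  have [||_] := forced_above (J + n%:Z); [by lia| |by lia].
  by move=> u v uI _ uv_stray; apply: left_clear; exists u, v; split=> //; lia.
have [i1 [j1 [i1I i1j1_corner below_clear]]] := lowest_stray_corner tP
  (W := fun i => i < I) (fun _ _ lt le => le_lt_trans le lt) left_stray.
have [i1j1_stray _] := i1j1_corner.
have Jj1 : J < j1.
  by rewrite ltNge; apply/negP => j1J; have := IJ_first _ _ i1j1_stray; lia.
have Ij1_clear : clear P I j1 by move=> u v uI; apply: below_clear; lia.
have [i1_down|i1_left] := stray_corner_heads tP i1j1_corner; last first.
  by suff : I <= i1 by [lia]; apply: I_min; exists j1.
have [forced_left _] := heads_down_forces tP i1j1_stray i1_down i1I Ij1_clear.
have [forced_below _] := forced_above j1 Jj1 Ij1_clear.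
exact: forced_at_flip_absurd tP forced_left forced_below.
Qed.

Lemma no_stray P u v : tiles_quadrant P -> ~ stray P u v.
Proof.
move=> tP uv_stray.
have [//||i [j [_ ij_corner below_clear]]] :=
    lowest_stray_corner tP (W := fun=> True).
  by exists u, v.
have [ij_down|ij_left] := stray_corner_heads tP ij_corner; last first.
  exact: stray_corner_not_heads_left tP ij_corner ij_left.
have [ij_stray _] := ij_corner.
have [||_] := heads_down_forces tP ij_stray ij_down (I := i + n%:Z);
  [by lia| |by lia].
by move=> u' v' _; apply: below_clear.
Qed.

(** * From placed tiles back to tilings *)

Lemma settled_hull_covered P t u v : settled P t -> hull t (u, v) ->
  exists t', [/\ P t', covers t' u v & hull t' = hull t].
Proof.
move=> [Pt Pt' _] /hullE /orP[tuv|tuv]; first by exists t.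
by exists (partner t); split=> //; apply: hull_partner.
Qed.

Lemma settled_hulls_partition P :
  tiles_quadrant P -> classical_sets.partition (hull @` settled P) id Q1.
Proof.
move=> tP; apply: partition_image => [|t _|t t' t_settled t'_settled].
- apply: cell_setP => u v; split=> [[t t_settled]|[u0 v0]].
    move=> /(settled_hull_covered t_settled) [t' [Pt' t'uv _]].
    exact: (covers_ge0 tP Pt' t'uv).
  have [t Pt tuv] := covered tP u0 v0.
  exists t; last by apply/hullE; rewrite tuv.
  by apply: contrapT => t_unsettled; apply: (@no_stray P u v tP); exists t.
- exists (hull_corner t).
  by case: t => [[[] x] y]; rewrite /hull /rectangle /=; lia.
move=> [[u v] [/(settled_hull_covered t_settled) [s [Ps suv <-]]]].
move=> /(settled_hull_covered t'_settled) [s' [Ps' s'uv <-]].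
by rewrite (covers_unique tP Ps Ps' suv s'uv).
Qed.

Lemma tiling_tiles_quadrant tau :
  tiling Q1 (ribbonL_plus n) tau -> tiles_quadrant (placed_tile @^-1` tau).
Proof.
move=> [tiles [cov triv _]].
split=> [u v u0 v0|t u v tau_t|t t' u v tau_t tau_t'].
- have : Q1 (u, v) by [].
  rewrite -cov => -[A tauA Auv].
  have [t At] := (translate_from_ribbonL_plus A).1 (tiles A tauA).
  by exists t; rewrite -?placed_tileE /= -?At.
- rewrite -placed_tileE => tuv.
  suff : Q1 (u, v) by [].
  by rewrite -cov; exists (placed_tile t).
- rewrite -!placed_tileE => tuv t'uv; apply: placed_tile_inj.
  by apply: triv => //; exists (u, v).
Qed.

Lemma settled_hull_pattern tau t :
  settled (placed_tile @^-1` tau) t -> pattern_rectangle n tau (hull t).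
Proof.
move=> [tau_t tau_t' t_even].
exists (hull_corner t).1, (hull_corner t).2, (hull_height t), (hull_base t).
split=> //.
  case: t t_even {tau_t tau_t'} => [[[] x] y]; rewrite /even_hull /= => t_even;
    by split=> /=; lia.
have [t_square|t_ribbon] := pselect (t.1.1 = Square).
  left; rewrite hull_tiles.
  case: t t_square tau_t {tau_t' t_even} => [[k x] y] /= -> tau_t.
  by do 3!split=> //; rewrite setUid //; exists T5, (x, y).
have [partner_ribbon partner_neq hull_shape] :
    [/\ (partner t).1.1 <> Square, t <> partner t &
        (hull_height t = 2%N /\ hull_base t = n) \/
        (hull_height t = n /\ hull_base t = 2%N)].
  by case: t t_ribbon {tau_t tau_t' t_even} => [[[] x] y] //=;
    split=> //; tauto.
right; split=> //; exists (placed_tile t), (placed_tile (partner t)); split.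
- by split=> //; apply: translate_from_ribbonL.
- by split=> //; apply: translate_from_ribbonL.
- by move/placed_tile_inj.
- exact: hull_tiles.
Qed.

Lemma tiling_follows_pattern tau :
  tiling Q1 (ribbonL_plus n) tau -> follows_rectangular_pattern n tau Q1.
Proof.
move=> /tiling_tiles_quadrant tP.
exists (hull @` settled (placed_tile @^-1` tau)); split=> [_ [t t_settled <-]|].
  exact: settled_hull_pattern.
exact: settled_hulls_partition.
Qed.

End RibbonTilings.

Lemma follows_pattern_ribbonL_plus n tau P :
  P !=set0 -> follows_rectangular_pattern n tau P ->
  exists2 A, tau A & translate_from (ribbonL_plus n) A.
Proof.
move=> [c Pc] [F [pat [cov _ _]]].
move: Pc; rewrite -cov => -[D /pat [x [y [a [b [_ _ D_tiles]]]]] _].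
case: D_tiles => [[_ [_ [tauD [_ [v [-> DT]]]]]]|[_ [A [_ [tauA _ _ _]]]]].
  by exists D => //; exists T5, v; split=> //; right.
case: tauA => tauA [T [v [ribbon_T AT]]].
by exists A => //; exists T, v; split=> //; left.
Qed.

(** * Grids of rectangles *)

Lemma translate_from_rectangle x y z w a b :
  translate_from [set rectangle x y a b] (rectangle z w a b).
Proof.
exists (rectangle x y a b), (z - x, w - y); split=> //.
by rewrite translate_rectangle; congr rectangle; lia.
Qed.

Definition grid_rectangle (a b : nat) (pq : int * int) : set cell :=
  rectangle (b%:Z * pq.1) (a%:Z * pq.2) a b.

Lemma divz_eqP (d : nat) (m q : int) :
  (0 < d)%N -> d%:Z * q <= m < d%:Z * q + d%:Z <-> (m %/ d)%Z = q.
Proof.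
move=> d0; rewrite mulrC -[X in _ < _ + X]mul1r -mulrDl.
rewrite -lez_divRL // -ltz_divLR //; lia.
Qed.

Lemma grid_rectangleE a b pq u v : (0 < a)%N -> (0 < b)%N ->
  grid_rectangle a b pq (u, v) <-> pq = ((u %/ b)%Z, (v %/ a)%Z).
Proof.
case: pq => p q a0 b0; rewrite /grid_rectangle /rectangle /= !divz_eqP //.
by split=> [[-> ->]|[-> ->]].
Qed.

Lemma grid_tiling a b : (0 < a)%N -> (0 < b)%N ->
  tiling Q1 [set rectangle 0 0 a b] (grid_rectangle a b @` Q1).
Proof.
move=> a0 b0; split=> [_ [pq _ <-]|].
  exact: translate_from_rectangle.
apply: partition_image => [|[p q] _|pq pq' _ _ [[u v] []]].
- apply: cell_setP => u v; split=> [[pq [p0 q0]]|[u0 v0]].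
    move/grid_rectangleE => /(_ a0 b0) pq_eq; move: p0 q0; rewrite pq_eq.
    by rewrite /= !lez_divRL // !mul0r.
  exists ((u %/ b)%Z, (v %/ a)%Z); first by rewrite /Q1 /= !divz_ge0.
  exact/grid_rectangleE.
- exists (b%:Z * p, a%:Z * q); rewrite /grid_rectangle /rectangle /=; lia.
- by move=> /grid_rectangleE -> // /grid_rectangleE ->.
Qed.

Lemma grid_not_pattern n a b : (4 <= n)%N -> odd a || odd b ->
  ~ follows_rectangular_pattern n (grid_rectangle a b @` Q1) Q1.
Proof.
move=> n_ge4 ab_odd; case/follows_pattern_ribbonL_plus; first by exists (0, 0).
move=> _ [pq _ <-] /translate_from_ribbonL_plus [t].
by move=> /(rectangle_eq_tile n_ge4) [a2 b2]; rewrite a2 b2 in ab_odd.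
Qed.

Theorem theorem1 (n : nat) (n_ge4 : (4 <= n)%N) (n_even : ~~ odd n) :
  ((forall tau, tiling Q1 (ribbonL_plus n) tau ->
      follows_rectangular_pattern n tau Q1) /\
   (forall tau, tiling Q1 (ribbonL n) tau ->
      follows_rectangular_pattern n tau Q1)) /\
  (forall a b : nat, (0 < a)%N -> (0 < b)%N -> odd a || odd b ->
     (exists tau,
        tiling Q1 (ribbonL_plus n `|` [set rectangle 0%R 0%R a b]) tau /\
        ~ follows_rectangular_pattern n tau Q1) /\
     (exists tau,
        tiling Q1 (ribbonL n `|` [set rectangle 0%R 0%R a b]) tau /\
        ~ follows_rectangular_pattern n tau Q1)).
Proof.
split=> [|a b a0 b0 ab_odd].
  split=> tau; first exact: tiling_follows_pattern.
  move=> tau_tiling; apply: tiling_follows_pattern => //.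
  by apply: tiling_subset tau_tiling; apply: subsetUl.
have grid := grid_tiling a0 b0.
have grid_odd := grid_not_pattern n_ge4 ab_odd.
by split; exists (grid_rectangle a b @` Q1); split=> //;
  apply: tiling_subset grid; apply: subsetUr.
Qed.
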